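(* Let $E$ be a real separated locally convex space and let $f,f_n\in\Lambda(E)$ $(n\ge1)$. Assume that $f(x)=\sum_{n\ge1}f_n(x)$ for every $x\in E$. (i) If $(x_n^* )_{n\ge1}\subset(\operatorname{dom}f_n^* )_{n\ge1}$ is such that $w^*\text{-}\sum_{n\ge1}x_n^*=x^*\in E^*$, then the sequence $\left(\sum_{k=1}^n f_k^*(x_k^* )\right)_{n\ge1}$ has a limit in $(-\infty,\infty]$ and $f^*(x^* )\le\sum_{n\ge1}f_n^*(x_n^* )$; in particular, $$f^*(x^* )\le\inf\Big\{\sum_{n\ge1}f_n^*(x_n^* )\ \Big|\ (x_n^* )_{n\ge1}\subset(\operatorname{dom}f_n^* )_{n\ge1},\ x^*=w^*\text{-}\sum_{n\ge1}x_n^*\Big\}$$ for every $x^*\in E^*$. (ii) If there exists $(x_n^* )_{n\ge1}\subset(\operatorname{dom}f_n^* )_{n\ge1}$ such that $w^*\text{-}\sum_{n\ge1}x_n^*=x^*\in E^*$ and $\sum_{n\ge1}f_n^*(x_n^* )\in\mathbb{R}$, then $x^*\in\operatorname{dom}f^*$. (iii) If $\overline{x}\in\bigcap_{n\ge1}\operatorname{dom}f_n$ and $(\overline{x}_n^* )_{n\ge1}\subset(\partial f_n(\overline{x}))_{n\ge1}$ is such that $w^*\text{-}\sum_{n\ge1}\overline{x}_n^*=x^*\in E^*$, then $\overline{x}\in\operatorname{dom}f$, $x^*\in\partial f(\overline{x})$ and $f^*(x^* )=\sum_{n\ge1}f_n^*(\overline{x}_n^* )$. In particular, $$f^*(x^*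 )=\min\Big\{\sum_{n\ge1}f_n^*(x_n^* )\ \Big|\ (x_n^* )_{n\ge1}\subset(\operatorname{dom}f_n^* )_{n\ge1},\ x^*=w^*\text{-}\sum_{n\ge1}x_n^*\Big\}. \qquad (\ast)$$ (iv) Let $x^*\in\partial f(\overline{x})$ with $\overline{x}\in\operatorname{dom}f$ and let $(x_n^* )_{n\ge1}\subset(\operatorname{dom}f_n^* )_{n\ge1}$ be such that $x^*=w^*\text{-}\sum_{n\ge1}x_n^*$. Then $f^*(x^* )=\sum_{n\ge1}f_n^*(x_n^* )$ if and only if $x_n^*\in\partial f_n(\overline{x})$ for every $n\ge1$. (v) Assume that $f$ and $f_n$ $(n\ge1)$ are continuous on $\operatorname{int}(\operatorname{dom}f)$. Then for every $x^*\in\partial f(\operatorname{int}(\operatorname{dom}f))$ the relation $(\ast)$ holds. More precisely, if $x^*\in\partial f(x)$ for $x\in\operatorname{int}(\operatorname{dom}f)$, then $x^*=w^*\text{-}\sum_{n\ge1}x_n^*$ for some $(x_n^* )_{n\ge1}\subset(\partial f_n(x))_{n\ge1}$, and $f^*(x^* )=\sum_{n\ge1}f_n^*(x_n^* )$.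
   Context: $E^*$ is the topological dual of $E$, with pairing $\langle x,x^*\rangle$; $w^*$ is the weak$^*$ topology on $E^*$. $\Lambda(E)$ is the set of proper convex functions $f:E\to(-\infty,\infty]$ (proper: not identically $\infty$); $\operatorname{dom}f=\{x:f(x)<\infty\}$. The equality $f(x)=\sum_{n\ge1}f_n(x)$ means that $\lim_{n\to\infty}\sum_{k=1}^nf_k(x)$ exists in $[-\infty,\infty]$ and equals $f(x)$; likewise $\sum_{n\ge1}f_n^*(x_n^* )$ denotes $\lim_{n\to\infty}\sum_{k=1}^n f_k^*(x_k^* )$. The conjugate is $f^*(x^* )=\sup_{x\in E}(\langle x,x^*\rangle-f(x))$ and $\operatorname{dom}f^*=\{x^*: f^*(x^* )<\infty\}$. For $x\in\operatorname{dom}f$, $\partial f(x)=\{x^*\in E^*:\langle y-x,x^*\rangle\le f(y)-f(x)\ \forall y\in E\}$, and $\partial f(A)=\bigcup_{x\in A}\partial f(x)$. The notation $(x_n)_{n\ge1}\subset(A_n)_{n\ge1}$ means $x_n\in A_n$ for every $n\ge1$; $x^*=w^*\text{-}\sum_{n\ge1}x_n^*$ means that $x^*$ is the weak$^*$ limit of $\sum_{k=1}^nx_k^*$ as $n\to\infty$. Convention: $\inf\emptyset=\infty$; ''$\min$'' means that the infimum is attained. *)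

(* Defs.v *)
From HB Require Import structures.
From mathcomp Require Import all_boot all_order all_algebra.
From mathcomp Require Import all_classical all_reals all_analysis.

Set Implicit Arguments.
Unset Strict Implicit.
Unset Printing Implicit Defensive.

Import Order.TTheory GRing.Theory Num.Theory.
Import numFieldNormedType.Exports.

Local Open Scope classical_set_scope.
Local Open Scope ring_scope.

(** Sequences [(u_n)_(n >= 1)] are indexed from 0 throughout: [u n] is the term
    of rank [n + 1], so [series u n] and [eseries u n] are the sums of its first
    [n] terms. *)

Section TopologicalDual.
Context {R : realType} (E : tvsType R).

Definition dual_pred : {pred (E -> R^o)} :=
  mem [set l : E -> R^o | linear l /\ continuous l].

Fact dual_pred_submod_closed : submod_closed dual_pred.
Proof.
split.
  rewrite inE /=; split; last by move=> x; exact: cvg_cst.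
  by move=> a u v /=; rewrite scaler0 addr0.
move=> a l m; rewrite !inE /= => -[linl contl] [linm contm]; split.
  move=> b u v; rewrite !fctE linl linm !scalerDr !scalerA (mulrC a b).
  by rewrite addrACA.
by move=> x; apply: cvgD; [apply: cvgZl_tmp; exact: contl|exact: contm].
Qed.

HB.instance Definition _ :=
  GRing.isSubmodClosed.Build R (E -> R^o) dual_pred dual_pred_submod_closed.

Record dual := Dual { dual_fun :> E -> R^o ; _ : dual_fun \in dual_pred }.

HB.instance Definition _ := [isSub for dual_fun].
HB.instance Definition _ := [Choice of dual by <:].
HB.instance Definition _ := [SubChoice_isSubLmodule of dual by <:].

(** The canonical topology on [dual] is the weak* topology: the initial topology
    for the evaluations at the points of [E]. *)
HB.instance Definition _ := Topological.copy dual
  (initial_topology (dual_fun : dual -> {ptws E -> R^o})).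

End TopologicalDual.

Section ConvexFunctions.
Context {R : realType} (E : tvsType R).
Local Open Scope ereal_scope.
Implicit Types f : E -> \bar R.

Definition dom (T : Type) (g : T -> \bar R) : set T := [set x | g x < +oo].

Definition econvex f := forall (x y : E) (t : R), (0 < t < 1)%R ->
  f (t *: x + (1 - t) *: y)%R <= t%:E * f x + (1 - t)%:E * f y.

Definition proper_convex f :=
  [/\ forall x, -oo < f x, dom f !=set0 & econvex f].

Definition conjugate f (x' : dual E) : \bar R :=
  ereal_sup [set (x' x)%:E - f x | x in [set: E]].

(** Meant for [x] in [dom f]; since [+oo - +oo = -oo] in [\bar R], the set is
    empty when [f x = +oo]. *)
Definition subdifferential f (x : E) : set (dual E) :=
  [set x' | forall y, (x' (y - x)%R)%:E <= f y - f x].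

Definition weak_star_sum (xs' : nat -> dual E) (x' : dual E) :=
  series xs' @ \oo --> x'.

Definition ereal_series_sum (u : nat -> \bar R) (l : \bar R) :=
  eseries u @ \oo --> l.

(** The set of all sums of the [conjugate (f_ n) (xs' n)], where [xs'] runs over
    the decompositions of [x'] with [xs' n] in [dom (conjugate (f_ n))]. *)
Definition decomposition_values (f_ : nat -> E -> \bar R) (x' : dual E) :
    set (\bar R) :=
  [set l | exists xs' : nat -> dual E,
    [/\ forall n, dom (conjugate (f_ n)) (xs' n),
        weak_star_sum xs' x' &
        ereal_series_sum (fun n => conjugate (f_ n) (xs' n)) l]].

Definition is_attained_inf (S : set (\bar R)) (m : \bar R) :=
  m = ereal_inf S /\ S m.

End ConvexFunctions.

(* Main.v *)
Require Import Defs.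
From mathcomp Require Import all_boot all_order all_algebra.
From mathcomp Require Import all_classical all_reals all_analysis.
From mathcomp Require Import ring lra.

(** Fix [x] in [dom f]. The Fenchel-Young gaps
    [f_n x + conjugate f_n x_n' - x_n' x] are nonnegative, so their series has a
    sum [G >= 0], and the partial sums of [conjugate f_n x_n'] tend to
    [G + x' x - f x]. This gives (i) and (ii); since [G = 0] if and only if all
    gaps vanish, i.e. every [x_n'] is a subgradient of [f_n] at [x], it also
    gives (iii) and (iv).

    For (v), let [x'] be a subgradient of [f] at [x] interior to [dom f]. On the
    space of eventually constant sequences [u : nat -> E], the linear form
    [(c, c, ...) |-> x' c] defined on the constant sequences lies below the
    convex function [u |-> \sum_n (f_n (x + u_n) - f_n x)]. Extend it by
    Hahn-Banach to [L] and let [x_n' c] be the value of [L] at the sequence with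
    [c] in position [n] and [0] elsewhere: it is a subgradient of [f_n] at [x].
    Finally [x' c - \sum_(k < n) x_k' c] is the value of [L] at
    [(0, ..., 0, c, c, ...)], which for every small [t > 0] is at most
    [t^-1 \sum_(k >= n) (f_k (x + t c) - f_k x)]; with the same bound for [- c],
    it tends to [0]. *)

Set Implicit Arguments.
Unset Strict Implicit.
Unset Printing Implicit Defensive.

Import Order.TTheory GRing.Theory Num.Theory.
Import numFieldNormedType.Exports.
Local Open Scope classical_set_scope.
Local Open Scope ereal_scope.

(** * Hahn-Banach extension below a convex epigraph *)

Section HahnBanach.
Context {R : realType} {V : lmodType R}.
Local Open Scope ring_scope.
Implicit Types (G K : set (V * R)) (W : set V).

(* Linear forms on subspaces and convex functions are represented by their
   graphs and epigraphs, as subsets of [V * R]. *)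
Definition linear_graph G := forall a u r v s,
  G (u, r) -> G (v, s) -> G (a *: u + v, a * r + s).

Definition convex_graph K := forall t u y v z, 0 < t < 1 ->
  K (u, y) -> K (v, z) -> K (t *: u + (1 - t) *: v, t * y + (1 - t) * z).

Definition below G K := forall v r y, G (v, r) -> K (v, y) -> r <= y.

Definition absorbed K v := exists t y, 0 < t /\ K (t *: v, y).

(** Points of [K] over [d - s *: v] bound the slope [c] from below, those over [d + t *: v] from
    above. Convexity puts every lower bound under every upper bound, and absorption of [v] and [- v]
    provides one of each, so the supremum of the lower bounds serves as [c]. *)
Lemma hahn_banach_step G K v : linear_graph G -> convex_graph K -> below G K ->
  G (0, 0) -> absorbed K v -> absorbed K (- v) ->
  exists c, forall d r t y, G (d, r) -> K (d + t *: v, y) -> r + t * c <= y.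
Proof.
move=> linG cK GK G0 [tp [yp [tp0 Kp]]] [tn [yn [tn0 Kn]]].
pose lower := [set a | exists d r s y,
  [/\ 0 < s, G (d, r), K (d - s *: v, y) & a = (r - y) / s]].
have lower_le a d r t y : lower a -> 0 < t -> G (d, r) -> K (d + t *: v, y) ->
    a <= (y - r) / t.
  move=> [d' [r' [s [y' [s0 Gd' Kd' ->]]]]] t0 Gd Kd.
  have st0 : 0 < s + t by exact: addr_gt0.
  (* With this weight the multiples of [v] cancel in the convex combination, which lands over the
     domain of [G]. *)
  pose w := s / (s + t).
  have w1 : 1 - w = t / (s + t) by rewrite /w; field; rewrite gt_eqF.
  have w01 : 0 < w < 1.
    by rewrite divr_gt0//= -subr_gt0 w1 divr_gt0.
  have Gw : G (w *: d + (1 - w) *: d', w * r + (1 - w) * r').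
    have := linG (1 - w) _ _ _ _ Gd' G0; rewrite !addr0.
    exact: linG.
  have := cK _ _ _ _ _ w01 Kd Kd'.
  have -> : w *: (d + t *: v) + (1 - w) *: (d' - s *: v) =
      w *: d + (1 - w) *: d'.
    rewrite scalerDr scalerBr !scalerA addrACA -scalerBl w1 /w.
    by rewrite [X in X *: v](_ : _ = 0) ?scale0r ?addr0//; ring.
  move=> /(GK _ _ _ Gw); rewrite w1 /w => le_ry.
  rewrite ler_pdivrMr// mulrAC ler_pdivlMr//.
  have : (s * r + t * r') <= (s * y + t * y').
    have := ler_wpM2l (ltW st0) le_ry.
    rewrite [X in X <= _](_ : _ = s * r + t * r'); last first.
      by field; rewrite gt_eqF.
    rewrite [X in _ <= X](_ : _ = s * y + t * y')//.
    by field; rewrite gt_eqF.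
  lra.
have lower0 : lower !=set0.
  exists (- yn / tn), 0, 0, tn, yn; split => //; last by rewrite sub0r.
  by rewrite sub0r -scalerN.
have lower_ub : has_ubound lower.
  exists (yp / tp) => a la.
  by have := lower_le a 0 0 tp yp la tp0 G0; rewrite add0r subr0; apply.
exists (sup lower) => d r t y Gd Kd.
have [t0|t0|t0] := ltgtP t 0.
- have : (r - y) / (- t) <= sup lower.
    apply: ub_le_sup => //; exists d, r, (- t), y; split => //.
      by rewrite oppr_gt0.
    by rewrite scaleNr opprK.
  rewrite ler_pdivrMr ?oppr_gt0//; lra.
- have : sup lower <= (y - r) / t.
    by apply: ge_sup => // a la; exact: (lower_le a d r t y).
  rewrite ler_pdivlMr//; lra.
- move: Kd; rewrite t0 scale0r addr0 mul0r addr0; exact: GK.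
Qed.

(** Zorn's lemma on graphs ordered by inclusion: a maximal graph missing a direction absorbed both
    ways could be enlarged by [hahn_banach_step]. *)
Lemma hahn_banach_graph G0 K :
  linear_graph G0 -> G0 (0, 0) -> convex_graph K -> below G0 K ->
  exists G, [/\ linear_graph G, G0 `<=` G, below G K &
    forall v, absorbed K v -> absorbed K (- v) -> exists r, G (v, r)].
Proof.
move=> linG0 G00 cK G0K.
(* The condition [G !=set0] lets the union of the empty chain satisfy [P]. *)
pose P G := [/\ linear_graph G, G !=set0 -> G0 `<=` G & below G K].
have [F FP totF|G [[linG G0G GK] maxG]] := @Zorn_bigcup _ P.
  split.
  - move=> a u r v s [X FX Xu] [Y FY Yv].
    have [XY|YX] := totF _ _ FX FY.
      by exists Y => //; have [+ _ _] := FP _ FY; apply => //; exact: XY.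
    by exists X => //; have [+ _ _] := FP _ FX; apply => //; exact: YX.
  - move=> [p [X FX Xp]] q G0q; exists X => //.
    by have [_ + _] := FP _ FX; apply => //; exists p.
  - move=> v r y [X FX Xv]; have [_ _ +] := FP _ FX; exact.
(* An empty [G] would be strictly contained in [G0], which satisfies [P]. *)
have Gn0 : G !=set0.
  apply/set0P/negP => /eqP Ge; apply: (maxG G0); last by split=> // _ p.
  by rewrite Ge; split=> // G0e; exact: (G0e (0, 0)).
have {}G0G := G0G Gn0.
have G_0 : G (0, 0) by exact: G0G.
exists G; split => // v Kv KNv; apply: contrapT => /forallNP Gv.
have [c cP] := @hahn_banach_step G K v linG cK GK G_0 Kv KNv.
pose G' := [set p | exists d r t, G (d, r) /\ p = (d + t *: v, r + t * c)].
apply: (maxG G').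
  split=> [[d r] Gd|/(_ (v, c)) G'G].
    by exists d, r, 0; rewrite scale0r mul0r !addr0.
  by apply: (Gv c); apply: G'G; exists 0, 0, 1; rewrite scale1r mul1r !add0r.
split=> [a u r w s|_ [d r] /G0G Gd|u r y].
- move=> [d [rd [t [Gd [-> ->]]]]] [d' [rd' [t' [Gd' [-> ->]]]]].
  exists (a *: d + d'), (a * rd + rd'), (a * t + t').
  split; first exact: linG.
  congr pair; last by ring.
  by rewrite scalerDr scalerA scalerDl addrACA.
- by exists d, r, 0; rewrite scale0r mul0r !addr0.
- by move=> [d [rd [t [Gd [-> ->]]]]]; exact: cP.
Qed.

(** The subspace [W] is a mere predicate and [L] a total function that is controlled on [W] only. As
    [W] is stable under opposites, its vectors are absorbed in both directions. *)
Lemma hahn_banach W G0 K :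
  W 0 -> (forall a u v, W u -> W v -> W (a *: u + v)) ->
  linear_graph G0 -> G0 (0, 0) -> convex_graph K -> below G0 K ->
  (forall v, W v -> absorbed K v) ->
  exists L : V -> R,
    [/\ forall a u v, W u -> W v -> L (a *: u + v) = a * L u + L v,
        forall v r, W v -> G0 (v, r) -> L v = r &
        forall v y, W v -> K (v, y) -> L v <= y].
Proof.
move=> W0 linW linG0 G00 cK G0K absK.
have [G [linG G0G GK Gv]] := hahn_banach_graph linG0 G00 cK G0K.
have WN v : W v -> W (- v).
  by move=> Wv; rewrite -[- v]addr0 -scaleN1r; exact: linW.
have {}Gv v : W v -> exists r, G (v, r).
  by move=> Wv; apply: Gv; apply: absK => //; exact: WN.
(* [G] is a graph: a multiple of a nonzero [s - r] with [(0, s - r)] in [G]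
   would exceed any [y] with [(0, y)] in [K]. *)
have Guniq v r s : G (v, r) -> G (v, s) -> r = s.
  move=> Gr Gs; have Grs : G (0, s - r).
    by have := linG (-1) _ _ _ _ Gr Gs; rewrite scaleN1r addNr mulN1r addrC.
  have [t [y [_]]] := absK _ W0; rewrite scaler0 => K0y.
  have le_y a : a * (s - r) <= y.
    have := linG a _ _ _ _ Grs (G0G _ G00).
    rewrite scaler0 !addr0 => /GK; exact.
  apply/eqP; rewrite eq_sym -subr_eq0; apply/negP => /negP rs0.
  have := le_y ((y + 1) / (s - r)); rewrite divfK// => ?; lra.
pose L v := xget 0 [set r | G (v, r)].
have LP v : W v -> G (v, L v).
  by move=> /Gv[r Gr]; exact: (xgetPex 0 (ex_intro [set r | G (v, r)] r Gr)).
exists L; split=> [a u v Wu Wv|v r Wv G0v|v y Wv].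
- apply: Guniq; first by apply/LP/linW.
  by apply: linG; exact: LP.
- by apply: Guniq; [exact: LP|exact: G0G].
- by apply: GK; exact: LP.
Qed.

End HahnBanach.

(** * Linear forms and weak* sums *)

Section Dual.
Context {R : realType} {E : tvsType R}.
Local Open Scope ring_scope.
Implicit Types (p : dual E) (ps : nat -> dual E).

Lemma dual_linear p : linear (p : E -> R^o).
Proof. by case: p => l /= /set_mem[]. Qed.

Lemma dualB p x y : p (x - y) = p x - p y.
Proof. by rewrite addrC -scaleN1r dual_linear scaleN1r addrC. Qed.

Lemma dual_seriesE ps n u : series ps n u = series (fun k => ps k u) n.
Proof.
rewrite /series/=; elim: n => [|n IHn]; first by rewrite !big_nil.
by rewrite !big_nat_recr//= -IHn.
Qed.

(** The topology of [dual] is initial for the map into functions with pointwise convergence, so its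
    neighborhoods come from preimages of open sets and convergence can be tested point by point. *)
Lemma weak_star_sumP ps p : weak_star_sum ps p <->
  forall u, series (fun n => ps n u) @ \oo --> p u.
Proof.
pose D := @dual_fun R E : dual E -> {ptws E -> R^o}.
have ptwsP : (D \o series ps @ \oo --> D p) <->
    forall u, series (fun n => ps n u) @ \oo --> p u.
  have seriesE u : series (fun n => ps n u) = (fun n => series ps n u).
    by apply/funext => n; rewrite dual_seriesE.
  split=> [/pointwise_cvgP cv u|cv]; first by rewrite seriesE; exact: cv.
  by apply/pointwise_cvgP => u; have := cv u; rewrite seriesE.
split=> [cv|/ptwsP cv].
  apply/ptwsP; apply: cvg_comp; first exact: cv.
  exact: initial_continuous.
move=> A /= [_ [[B oB <-] Bp BA]].
apply: filterS BA _; apply: cv.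
exact: open_nbhs_nbhs.
Qed.

End Dual.

(** * Conjugates, subgradients and the Fenchel-Young inequality *)

Section Conjugate.
Context {R : realType} {E : tvsType R}.
Implicit Types (g : E -> \bar R) (x : E) (p : dual E).

Lemma conjugate_ge g x p : (p x)%:E - g x <= conjugate g p.
Proof. by apply: ereal_sup_ubound; exists x. Qed.

Lemma conjugate_gtNy g x p : dom g x -> -oo < conjugate g p.
Proof.
move=> gx; apply: lt_le_trans (conjugate_ge g x p).
by move: gx; rewrite /dom/=; case: (g x) => [a _| |_]//=; rewrite -?EFinB ltNyr.
Qed.

(** The subgradient inequality, rearranged, says that the supremum defining the conjugate is
    attained at [x]. *)
Lemma subdifferentialP g x p : g x \is a fin_num ->
  (subdifferential g x p <-> conjugate g p = (p x)%:E - g x).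
Proof.
move=> gx; split=> [gp|gp y].
  apply/eqP; rewrite eq_le conjugate_ge andbT.
  apply: ge_ereal_sup => _ [y _ <-].
  have := gp y; rewrite dualB.
  case: (g x) gx => // a _; case: (g y) => [b| |]//=.
  - by rewrite -!EFinB !lee_fin; lra.
  - by rewrite leNye.
have := conjugate_ge g y p; rewrite gp dualB.
case: (g x) gx => // a _; case: (g y) => [b| |]//=.
- by rewrite -!EFinB !lee_fin; lra.
- by rewrite leey.
Qed.

Lemma fenchel_young g x p : g x \is a fin_num ->
  0 <= g x + conjugate g p - (p x)%:E.
Proof.
move=> gx; have := conjugate_ge g x p.
case: (g x) gx => // a _; case: (conjugate g p) => [b| |]//=.
- by rewrite -EFinD -!EFinB !lee_fin; lra.
- by move=> _; rewrite leey.
Qed.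

Lemma fenchel_young_eq g x p : g x \is a fin_num ->
  subdifferential g x p <-> g x + conjugate g p - (p x)%:E = 0.
Proof.
move=> gx; rewrite (subdifferentialP _ gx).
case: (g x) gx => // a _; split=> [->|].
  by rewrite /= -!EFinD; congr EFin; ring.
case: (conjugate g p) => [b| |]//= [] ?; congr EFin; lra.
Qed.

End Conjugate.

(** * Series of extended reals *)

Section Series.
Context {R : realType}.

Lemma eseries_EFin (u : nat -> R) :
  eseries (fun n => (u n)%:E) = EFin \o series u.
Proof. by apply/funext => n; rewrite /eseries /series/= sumEFin. Qed.

(** Since no term is [-oo], a single term [+oo] would force the sum to be [+oo]. *)
Lemma eseries_fin_num (u : nat -> \bar R) l : (forall n, -oo < u n) ->
  ereal_series_sum u l -> l < +oo -> forall n, u n \is a fin_num.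
Proof.
move=> uNy ul ly n; rewrite fin_numE (gt_eqF (uNy n))/=; apply/eqP => un.
have : \sum_(i <oo) u i = +oo.
  by apply: (@eseries_pinfty _ _ _ n) => // i _; rewrite (gt_eqF (uNy i)).
by move=> u_y; move: ly; rewrite -(cvg_lim _ ul)// u_y ltxx.
Qed.

End Series.

(** * The series of conjugates, computed at a point of the domain of [f] *)

Section SumOfConvex.
Context {R : realType} {E : tvsType R}.
Variables (f : E -> \bar R) (f_ : nat -> E -> \bar R).
Hypotheses (fNy : forall x, -oo < f x) (fnNy : forall n x, -oo < f_ n x).
Hypothesis f_sum : forall x, ereal_series_sum (fun n => f_ n x) (f x).

Lemma dom_fin_num x : dom f x -> f x \is a fin_num.
Proof. by move=> fx; rewrite fin_numElt fNy. Qed.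

Lemma dom_fin_num_nth x : dom f x -> forall n, f_ n x \is a fin_num.
Proof. exact: (eseries_fin_num (fun n => fnNy n x) (@f_sum x)). Qed.

Let gap (ps : nat -> dual E) x n :=
  f_ n x + conjugate (f_ n) (ps n) - (ps n x)%:E.

Lemma conjugate_series (ps : nat -> dual E) p x :
  (forall n, dom (conjugate (f_ n)) (ps n)) -> weak_star_sum ps p -> dom f x ->
  ereal_series_sum (fun n => conjugate (f_ n) (ps n))
    (\sum_(n <oo) gap ps x n + ((p x)%:E - f x)).
Proof.
move=> dps psp fx; have fin := dom_fin_num_nth fx.
have cfin n : conjugate (f_ n) (ps n) \is a fin_num.
  rewrite fin_numElt dps andbT; apply: (@conjugate_gtNy _ _ _ x).
  by rewrite /dom/=; move: (fin n); rewrite fin_numElt => /andP[].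
pose a n := fine (f_ n x); pose c n := fine (conjugate (f_ n) (ps n)).
have gapE n : gap ps x n = (a n + c n - ps n x)%:E.
  by rewrite /gap -(fineK (fin n)) -(fineK (cfin n)).
have gap_cvg : eseries (gap ps x) @ \oo --> \sum_(n <oo) gap ps x n.
  by apply: is_cvg_nneseries => n _ _; exact: fenchel_young.
have p_cvg : EFin \o series (fun n => ps n x) @ \oo --> (p x)%:E.
  by apply: cvg_EFin; [exact: nearW|exact: (weak_star_sumP _ _).1].
(* The sum of the gaps may be [+oo], but [p x - f x] is finite, so the limits can be added. *)
have := cvgeD _ gap_cvg (cvgeB _ p_cvg (@f_sum x)).
rewrite /ereal_series_sum.
rewrite [X in _ -> X @ _ --> _](_ : _ =
  (fun n => eseries (gap ps x) n +
    ((EFin \o series (fun n => ps n x)) n - eseries (fun n => f_ n x) n))).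
  by apply; rewrite ?fin_num_adde_defl// ?fin_numB ?fin_numN ?dom_fin_num.
apply/funext => n.
rewrite (_ : gap ps x = fun n => (a n + c n - ps n x)%:E); last exact/funext.
rewrite (_ : (fun n => f_ n x) = fun n => (a n)%:E); last first.
  by apply/funext => i; rewrite fineK.
rewrite (_ : (fun n => conjugate (f_ n) (ps n)) = fun n => (c n)%:E);
  last first.
  by apply/funext => i; rewrite fineK.
rewrite !eseries_EFin /= -EFinB -EFinD; congr EFin.
rewrite /series/= -sumrB -big_split/=; apply: eq_bigr => i _; ring.
Qed.

End SumOfConvex.

(** * Upper bounds and exact formulas for the conjugate of the sum *)

Section ConjugateOfSum.
Context {R : realType} {E : tvsType R}.
Variables (f : E -> \bar R) (f_ : nat -> E -> \bar R).
Hypotheses (fNy : forall x, -oo < f x) (fnNy : forall n x, -oo < f_ n x).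
Hypothesis (f0 : dom f !=set0).
Hypothesis f_sum : forall x, ereal_series_sum (fun n => f_ n x) (f x).

(** By uniqueness of limits, the value of the series found at [x0] is also the one found at any
    other [x] in [dom f]. It is therefore at least [p x - f x] for all these [x], hence at least
    their supremum. *)
Lemma conjugate_sum_le (ps : nat -> dual E) p :
  (forall n, dom (conjugate (f_ n)) (ps n)) -> weak_star_sum ps p ->
  exists l, [/\ -oo < l, ereal_series_sum (fun n => conjugate (f_ n) (ps n)) l &
    conjugate f p <= l].
Proof.
move=> dps psp; have [x0 fx0] := f0.
have cvg_at x (fx : dom f x) := conjugate_series fNy fnNy f_sum dps psp fx.
have gap_ge0 x : dom f x ->
    0 <= \sum_(n <oo) (f_ n x + conjugate (f_ n) (ps n) - (ps n x)%:E).
  move=> fx; apply: nneseries_ge0 => n _ _.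
  by apply: fenchel_young; exact: (dom_fin_num_nth fnNy f_sum fx).
eexists; split; last 2 first.
- exact: cvg_at fx0.
- apply: ge_ereal_sup => _ [x _ <-].
  have [fx|fx] := pselect (dom f x).
    rewrite (cvg_unique (@ereal_hausdorff R) (cvg_at _ fx0) (cvg_at _ fx)).
    by rewrite leeDr// gap_ge0.
  have -> : f x = +oo.
    by apply/eqP; rewrite -leye_eq leNgt; apply/negP; exact: fx.
  exact: leNye.
- apply: (@lt_le_trans _ _ ((p x0)%:E - f x0)); last by rewrite leeDr// gap_ge0.
  have := dom_fin_num fNy fx0; case: (f x0) => // b _.
  by rewrite -EFinB ltNyr.
Qed.

Lemma conjugate_le_inf (p : dual E) :
  conjugate f p <= ereal_inf (decomposition_values f_ p).
Proof.
apply: le_ereal_inf_tmp => l [ps [dps psp psl]].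
have [m [_ psm]] := conjugate_sum_le dps psp.
by rewrite (cvg_unique (@ereal_hausdorff R) psl psm).
Qed.

(** Summing the subgradient inequalities between [x] and some [x0] in [dom f] bounds [f x] by the
    finite number [f x0 - p (x0 - x)]. *)
Lemma dom_sum_subdifferential x (ps : nat -> dual E) p :
  (forall n, dom (f_ n) x) -> (forall n, subdifferential (f_ n) x (ps n)) ->
  weak_star_sum ps p -> dom f x.
Proof.
move=> fnx dps psp; have [x0 fx0] := f0.
have fin0 n := dom_fin_num_nth fnNy f_sum fx0 n.
have fin n : f_ n x \is a fin_num by rewrite fin_numElt fnNy fnx.
have p_cvg : EFin \o series (fun n => ps n (x0 - x)%R) @ \oo -->
    (p (x0 - x)%R)%:E.
  by apply: cvg_EFin; [exact: nearW|exact: (weak_star_sumP _ _).1].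
have fx0fin := dom_fin_num fNy fx0.
have cvgB : (fun n => eseries (fun k => f_ k x0) n -
    (EFin \o series (fun k => ps k (x0 - x)%R)) n) @ \oo -->
    f x0 - (p (x0 - x)%R)%:E.
  by apply: cvgeB => //; [rewrite fin_num_adde_defl|exact: f_sum].
have : f x <= f x0 - (p (x0 - x)%R)%:E.
  apply: (lee_cvg_to (@f_sum x) cvgB).
  apply: nearW => n.
  rewrite (_ : (fun n => f_ n x0) = fun n => (fine (f_ n x0))%:E); last first.
    by apply/funext => i; rewrite fineK.
  rewrite (_ : (fun n => f_ n x) = fun n => (fine (f_ n x))%:E); last first.
    by apply/funext => i; rewrite fineK.
  rewrite !eseries_EFin/= -EFinB lee_fin /series/= -sumrB.
  apply: ler_sum => i _.
  have := dps i x0; rewrite -(fineK (fin0 i)) -(fineK (fin i)) -EFinB lee_fin/=.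
  lra.
by move=> /le_lt_trans; apply; rewrite -(fineK fx0fin) -EFinB ltry.
Qed.

(** All gaps vanish, so the conjugates sum to [p x - f x]. This is at most [conjugate f p] by
    definition and at least it by [conjugate_sum_le]; equality makes [p] a subgradient and [ps] a
    minimizer. *)
Lemma subdifferential_sum x (ps : nat -> dual E) p :
  (forall n, dom (f_ n) x) -> (forall n, subdifferential (f_ n) x (ps n)) ->
  weak_star_sum ps p ->
  [/\ dom f x, subdifferential f x p,
    ereal_series_sum (fun n => conjugate (f_ n) (ps n)) (conjugate f p) &
    is_attained_inf (decomposition_values f_ p) (conjugate f p)].
Proof.
move=> fnx dps psp; have fx := dom_sum_subdifferential fnx dps psp.
have fin := dom_fin_num fNy fx.
have finn n := dom_fin_num_nth fnNy f_sum fx n.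
have dcps n : dom (conjugate (f_ n)) (ps n).
  rewrite /dom/= ((subdifferentialP _ (finn n)).1 (dps n)).
  by rewrite -(fineK (finn n)) -EFinB ltry.
have := conjugate_series fNy fnNy f_sum dcps psp fx.
rewrite eseries0 ?add0e; last first.
  by move=> n _ _; apply: (fenchel_young_eq _ (finn n)).1.
move=> pcvg.
have pf : conjugate f p = (p x)%:E - f x.
  apply/eqP; rewrite eq_le conjugate_ge andbT.
  have [l [_ psl]] := conjugate_sum_le dcps psp.
  by rewrite (cvg_unique (@ereal_hausdorff R) pcvg psl).
have psum : ereal_series_sum (fun n => conjugate (f_ n) (ps n)) (conjugate f p).
  by rewrite pf.
have fdec : decomposition_values f_ p (conjugate f p) by exists ps.
split=> //; first exact/subdifferentialP.
split=> //; apply/eqP; rewrite eq_le conjugate_le_inf/=.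
exact: ereal_inf_lbound.
Qed.

Lemma conjugate_sum_eqP x (ps : nat -> dual E) p :
  dom f x -> subdifferential f x p ->
  (forall n, dom (conjugate (f_ n)) (ps n)) -> weak_star_sum ps p ->
  ereal_series_sum (fun n => conjugate (f_ n) (ps n)) (conjugate f p) <->
  (forall n, subdifferential (f_ n) x (ps n)).
Proof.
move=> fx fxp dcps psp; have fin := dom_fin_num fNy fx.
have finn n := dom_fin_num_nth fnNy f_sum fx n.
have fnx n : dom (f_ n) x by have := finn n; rewrite fin_numElt => /andP[].
split=> [pcvg n|dps]; last by have [] := subdifferential_sum fnx dps psp.
apply/(fenchel_young_eq _ (finn n)).
have := conjugate_series fNy fnNy f_sum dcps psp fx.
move=> /(cvg_unique (@ereal_hausdorff R) pcvg).
rewrite ((subdifferentialP _ fin).1 fxp).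
set S := \sum_(_ <oo) _ => SE.
(* [SE] reads [p x - f x = S + (p x - f x)] with [p x - f x] finite, which also excludes infinite
   [S]. *)
have S0 : S = 0.
  move: SE; rewrite -(fineK fin) -EFinB; case: S => [s []|//|//] ?.
  congr EFin; lra.
have gap_ge0 k : 0 <= f_ k x + conjugate (f_ k) (ps k) - (ps k x)%:E.
  exact: fenchel_young.
apply/eqP; rewrite eq_le gap_ge0 andbT -S0 /S.
rewrite (@nneseriesD1 _ _ n predT)//.
by rewrite leeDl//; apply: nneseries_ge0 => k _ _; exact: gap_ge0.
Qed.

End ConjugateOfSum.

(** * Continuity of linear forms, small steps along rays, finite series *)

Section Rays.
Context {R : realType} {E : tvsType R}.
Local Open Scope ring_scope.

(** The upper bound, applied to both [u - z] and its opposite, is a two-sided one. *)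
Lemma continuous_linear_bounded_above (l : E -> R^o) : linear l ->
  (forall e : R, 0 < e -> \forall u \near (0 : E), l u <= e) -> continuous l.
Proof.
move=> linl lub z.
have lB a b : l (a - b) = l a - l b.
  by rewrite addrC -scaleN1r linl scaleN1r addrC.
have lN a : l (- a) = - l a by rewrite -sub0r lB -(subrr a) lB subrr sub0r.
apply/cvgrPdist_le => e e0.
have subz : (fun u => u - z) @ z --> (0 : E).
  rewrite -[X in _ --> X](subrr z); apply: (@continuous_comp _ _ _
    (fun u => (u, z)) (fun w : E * E => w.1 - w.2)); last exact: sub_continuous.
  by apply: cvg_pair => /=; [exact: cvg_id|exact: cvg_cst].
have subzN : (fun u => - (u - z)) @ z --> (0 : E).
  rewrite -[X in _ --> X]oppr0.
  exact: (cvg_comp (fun u => u - z) -%R subz (@opp_continuous E 0)).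
have le1 : \forall u \near z, l (u - z) <= e := subz _ (lub e e0).
have le2 : \forall u \near z, l (- (u - z)) <= e := subzN _ (lub e e0).
apply: filterS2 le1 le2 => u; rewrite opprB -lB ler_norml => le1 le2.
by rewrite lerNl -lN opprB le1.
Qed.

Lemma near_ray (U : set E) (x v : E) : nbhs x U ->
  \forall t \near (0 : R)^'+, U (x + t *: v).
Proof.
move=> Ux.
have : (fun t : R^o => x + t *: v) @ (0 : R^o) --> x.
  rewrite -[X in _ --> X]addr0 -(scale0r v).
  apply: (@continuous_comp _ _ _ (fun t : R^o => (x, t *: v))
    (fun w : E * E => w.1 + w.2)); last exact: add_continuous.
  apply: cvg_pair => /=; first exact: cvg_cst.
  apply: (@continuous_comp _ _ _ (fun t : R^o => (t, v))
    (fun w : R^o * E => w.1 *: w.2)); last exact: scale_continuous.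
  apply: (@cvg_pair _ _ _ _ (nbhs (0 : R^o))); first exact: cvg_id.
  exact: cvg_cst.
by move=> /(_ _ Ux) nU; rewrite near_withinE; near=> t => _; near: t; exact: nU.
Unshelve. all: by end_near.
Qed.

(** One step [t] serves finitely many directions, in particular all values of an eventually constant
    sequence. *)
Lemma near_rays (U : set E) (x : E) (v : nat -> E) N : nbhs x U ->
  \forall t \near (0 : R)^'+, forall n, (n < N)%N -> U (x + t *: v n).
Proof.
move=> Ux; elim: N => [|N]; first exact: nearW.
apply: filterS2 (near_ray (v N) Ux) => t UN IHN n.
by rewrite ltnS leq_eqVlt => /predU1P[->//|]; exact: IHN.
Qed.

Lemma cvg_series_near0 (a : nat -> R) N : (forall n, (N <= n)%N -> a n = 0) ->
  series a @ \oo --> series a N.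
Proof.
move=> a0; apply: cvg_near_cst; near=> n.
rewrite /series/= (@big_cat_nat _ _ _ N)//=; last by near: n; exists N.
rewrite [X in _ + X]big_nat_cond [X in _ + X]big1 ?addr0// => i.
by rewrite andbT => /andP[+ _]; exact: a0.
Unshelve. all: by end_near. Qed.

End Rays.

(** * Decomposition of a subgradient of the sum at an interior point *)

Section Decomposition.
Context {R : realType} {E : tvsType R}.
Variables (f : E -> \bar R) (f_ : nat -> E -> \bar R).
Hypotheses (fNy : forall x, -oo < f x) (fnNy : forall n x, -oo < f_ n x).
Hypothesis fn_convex : forall n, econvex (f_ n).
Hypothesis f_sum : forall x, ereal_series_sum (fun n => f_ n x) (f x).
Variables (x : E) (p : dual E).
Hypotheses (xint : (dom f)° x) (fxp : subdifferential f x p).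

Let fx : dom f x. Proof. exact: interior_subset xint. Qed.

Let fin_nth z (fz : dom f z) n : f_ n z = (fine (f_ n z))%:E.
Proof. by rewrite fineK//; exact: (dom_fin_num_nth fnNy f_sum fz). Qed.

(** This space contains the constant, one-term and tail sequences on which the extended form is
    evaluated, yet each member takes finitely many values, as absorption requires. *)
Let eventually_constant : set (nat -> E) :=
  [set u | exists N c, forall n, (N <= n)%N -> u n = c].

Let diagonal_graph : set ((nat -> E) * R) :=
  [set q | exists c, q = (fun=> c, p c)].

(* The epigraph of [u |-> \sum_n (f_n (x + u_n) - f_n x)] up to closure; asking
   for a termwise bound [a] instead of the value of the sum makes its convexity
   immediate. *)
Let sum_epigraph : set ((nat -> E) * R) := [set q | exists2 a : nat -> R,
  forall n, f_ n (x + q.1 n)%R <= f_ n x + (a n)%:E & series a @ \oo --> q.2].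

Let series_fine z : dom f z ->
  series (fun n => fine (f_ n z)) @ \oo --> fine (f z).
Proof.
move=> fz; have := @f_sum z; rewrite /ereal_series_sum.
rewrite (_ : (fun n => f_ n z) = fun n => (fine (f_ n z))%:E); last first.
  by apply/funext => n; rewrite -fin_nth.
rewrite eseries_EFin -{1}(fineK (dom_fin_num fNy fz)); exact: fine_cvg.
Qed.

Let series_increment z : dom f z ->
  series (fun n => fine (f_ n z) - fine (f_ n x))%R @ \oo -->
    (fine (f z) - fine (f x))%R.
Proof.
move=> fz; rewrite (_ : series _ = fun n =>
  (series (fun n => fine (f_ n z)) n - series (fun n => fine (f_ n x)) n)%R).
  by apply: cvgB; exact: series_fine.
by apply/funext => n; rewrite /series/= sumrB.
Qed.

Let increment_le z n : dom f z ->
  f_ n z <= f_ n x + (fine (f_ n z) - fine (f_ n x))%:E.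
Proof.
by move=> fz; rewrite (fin_nth fz) (fin_nth fx) -EFinD lee_fin /=; lra.
Qed.

Let sum_epigraph_convex : convex_graph sum_epigraph.
Proof.
move=> t u y v z t01 [a au ay] [b bv bz] /=; have /andP[t0 t1] := t01.
exists (fun n => t * a n + (1 - t) * b n)%R.
  move=> n /=.
  rewrite (_ : (x + _)%R = (t *: (x + u n) + (1 - t) *: (x + v n))%R);
    last first.
    rewrite !scalerDr addrACA -scalerDl; congr (_ + _)%R.
    by rewrite [X in (X *: x)%R](_ : _ = 1%R) ?scale1r//; ring.
  apply: (le_trans (fn_convex n _ _ t01)).
  have t0' : 0 <= t%:E by rewrite lee_fin ltW.
  have t1' : 0 <= (1 - t)%:E by rewrite lee_fin subr_ge0 ltW.
  apply: (le_trans (leeD (lee_wpmul2l t0' (au n)) (lee_wpmul2l t1' (bv n)))).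
  by rewrite (fin_nth fx) -!EFinD lee_fin/=; lra.
rewrite (_ : series _ =
    fun n => (t * series a n + (1 - t) * series b n)%R); last first.
  by apply/funext => n; rewrite /series/= big_split/= -!mulr_sumr.
by apply: cvgD; apply: cvgM => //; exact: cvg_cst.
Qed.

(** Summing the termwise bounds gives [f (x + c) <= f x + y], and the subgradient inequality gives
    [p c <= f (x + c) - f x]. *)
Let diagonal_below : below diagonal_graph sum_epigraph.
Proof.
move=> _ _ y [c [-> ->]] [a /= ac ay].
have le_fxc : f (x + c)%R <= f x + y%:E.
  have fay : (fun n => eseries (fun k => f_ k x) n + (EFin \o series a) n)
      @ \oo --> f x + y%:E.
    apply: cvgeD; [by rewrite fin_num_adde_defl|exact: f_sum|].
    by apply: cvg_EFin => //; exact: nearW.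
  apply: (lee_cvg_to (@f_sum (x + c)%R) fay); apply: nearW => n.
  rewrite -eseries_EFin -[leRHS]big_split/=.
  by apply: lee_sum => i _; exact: ac.
have := fxp (x + c)%R; rewrite addrAC subrr add0r.
have := dom_fin_num fNy fx; case: (f x) le_fxc => // r le_fxc _ pc.
rewrite -lee_fin; apply: (le_trans pc).
by rewrite leeBlDr// addeC.
Qed.

(** The increments along [t *: u] differ from those along the constant [t *: c] in finitely many
    terms, and the latter are summable once [x + t *: c] lies in [dom f]. *)
Let eventually_constant_absorbed u :
  eventually_constant u -> absorbed sum_epigraph u.
Proof.
move=> [N [c uN]].
(* The bound [N.+1] includes the index [N], where [u] already equals [c]. *)
have /filter_ex[t /= [t0 tdom]] : \forall t \near (0 : R)^'+,
    (0 < t)%R /\ forall n, (n < N.+1)%N -> dom f (x + t *: u n)%R.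
  near=> t; split; first by near: t; exact: nbhs_right_gt.
  by near: t; apply: near_rays; exact: xint.
have {}tdom n : dom f (x + t *: u n)%R.
  have [nN|Nn] := ltnP n N.+1; first exact: tdom.
  by rewrite uN ?(ltnW Nn)// -(uN N (leqnn N)); exact: (tdom N).
pose a n := (fine (f_ n (x + t *: u n)%R) - fine (f_ n x))%R.
pose b n := (fine (f_ n (x + t *: c)%R) - fine (f_ n x))%R.
have ab n : (N <= n)%N -> (a n - b n = 0)%R.
  by move=> Nn; rewrite /a /b uN// subrr.
have cdom : dom f (x + t *: c)%R by rewrite -(uN N (leqnn N)).
exists t; eexists; split => //; exists a => [n|].
  exact: (increment_le n (tdom n)).
rewrite /= (_ : series a = fun n =>
  (series (fun n => a n - b n) n + series b n)%R).
  by apply: cvgD; [exact: cvg_series_near0 ab|exact: series_increment].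
apply/funext => n; rewrite /series/= -big_split/=.
by apply: eq_bigr => i _; rewrite subrK.
Unshelve. all: by end_near. Qed.

Let single n (u : E) : nat -> E := fun k => if k == n then u else 0%R.
Let tail n (u : E) : nat -> E := fun k => if (n <= k)%N then u else 0%R.

Hypothesis fn_continuous : forall n, {for x, continuous (f_ n)}.

Lemma subdifferential_decomposition : exists ps : nat -> dual E,
  (forall n, subdifferential (f_ n) x (ps n)) /\ weak_star_sum ps p.
Proof.
have plin := dual_linear p.
have p0 : p 0%R = 0%R :> R by rewrite -(subrr (0 : E)%R) dualB subrr.
have [|||||||L [linL L_diag L_le]] := @hahn_banach R (nat -> E)
    eventually_constant diagonal_graph sum_epigraph.
- by exists 0%N, 0%R.
- move=> a u v [N [c uN]] [M [d vM]]; exists (maxn N M), (a *: c + d)%R => n.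
  by rewrite geq_max => /andP[Nn Mn]; rewrite -(uN n Nn) -(vM n Mn).
- move=> a _ _ _ _ [c [-> ->]] [d [-> ->]]; exists (a *: c + d)%R.
  by congr pair; rewrite plin.
- by exists 0%R; rewrite p0.
- exact: sum_epigraph_convex.
- exact: diagonal_below.
- exact: eventually_constant_absorbed.
have c_single n u : eventually_constant (single n u).
  by exists n.+1, 0%R => k nk; rewrite /single gtn_eqF.
have c_tail n u : eventually_constant (tail n u).
  by exists n, u => k nk; rewrite /tail nk.
have L0 : L 0%R = 0%R.
  by have := L_diag 0%R 0%R (c_tail 0%N 0%R); apply; exists 0%R; rewrite p0.
have c0 : eventually_constant 0%R by exists 0%N, 0%R.
have LZ a u : eventually_constant u -> L (a *: u)%R = (a * L u)%R.
  by move=> cu; rewrite -[X in L X]addr0 linL// L0 addr0.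
have LD u v : eventually_constant u -> eventually_constant v ->
    L (u + v)%R = (L u + L v)%R.
  by move=> cu cv; rewrite -[X in L (X + _)%R]scale1r linL// mul1r.
pose l n : E -> R^o := fun u => L (single n u).
have l_lin n : linear (l n).
  move=> a u v; rewrite /l -linL//; congr L; apply/funext => k.
  by rewrite /single !fctE; case: ifP => //; rewrite scaler0 addr0.
have l_le n u y : f_ n (x + u)%R <= f_ n x + y%:E -> (l n u <= y)%R.
  (* Off position [n] the sequence does not move [x], so the bound [0] holds there and the bounds
     sum to [y]. *)
  move=> fny; apply: L_le => //; exists (fun k => if k == n then y else 0%R).
    move=> k /=; rewrite /single; case: eqP => [->//|_].
    by rewrite addr0 adde0.
  rewrite /= [X in _ --> X](_ : y =
    series (fun k => if k == n then y else 0%R) n.+1).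
    by apply: cvg_series_near0 => k nk; rewrite gtn_eqF.
  rewrite /series/= big_nat_recr//= eqxx big_nat_cond big1 ?add0r// => i.
  by rewrite andbT => /andP[_ /ltn_eqF ->].
(* Continuity of [f_ n] at [x] bounds its increments by [e] near [0], and [l_le] passes this bound
   on to [l n]. *)
have l_cont n : continuous (l n).
  apply: continuous_linear_bounded_above => // e e0.
  have lt_e : f_ n x < f_ n x + e%:E.
    by rewrite (fin_nth fx) -EFinD lte_fin ltrDl.
  have lt_nbhs : nbhs (f_ n x) [set r | r < f_ n x + e%:E].
    by apply: open_nbhs_nbhs; split => //; exact: open_ereal_lt_ereal.
  have near_x := @fn_continuous n _ lt_nbhs.
  have near_0 : \forall u \near (0 : E)%R, f_ n (x + u)%R < f_ n x + e%:E.
    have : (fun u => x + u)%R @ (0 : E)%R --> x.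
      rewrite -[X in _ --> X]addr0.
      apply: (@continuous_comp _ _ _ (fun u => (x, u))
        (fun w : E * E => w.1 + w.2)%R); last exact: add_continuous.
      by apply: cvg_pair => /=; [exact: cvg_cst|exact: cvg_id].
    by move=> /(_ _ near_x).
  by apply: filterS near_0 => u /ltW; exact: l_le.
have L_tail u e : (0 < e)%R -> \forall n \near \oo, (L (tail n u) <= e)%R.
  move=> e0.
  have /filter_ex[t /= [t0 tdom]] : \forall t \near (0 : R)^'+,
      (0 < t)%R /\ dom f (x + t *: u)%R.
    near=> t; split; first by near: t; exact: nbhs_right_gt.
    by near: t; apply: near_ray; exact: xint.
  pose a n := (fine (f_ n (x + t *: u)%R) - fine (f_ n x))%R.
  have aA := series_increment tdom.
  set A := (_ - _ : R)%R in aA.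
  (* The increments of rank at least [n] bound [tail n (t *: u)] termwise; they sum to the remainder
     of a convergent series. *)
  have LA n : (t * L (tail n u) <= A - series a n)%R.
    rewrite -LZ//; apply: L_le.
      by exists n, (t *: u)%R => k nk; rewrite fctE /tail nk.
    exists (fun k => if (n <= k)%N then a k else 0%R).
      move=> k /=; rewrite fctE /tail; case: ifP => _.
        exact: increment_le tdom.
      by rewrite scaler0 addr0 adde0.
    have : (fun m => series a m - series a n)%R @ \oo --> (A - series a n)%R.
      by apply: cvgB => //; exact: cvg_cst.
    apply: cvg_trans; apply: near_eq_cvg; near=> m.
    have nm : (n <= m)%N by near: m; exists n.
    rewrite /series/= !(@big_cat_nat _ _ _ n 0 m)//= addrAC subrr add0r.
    rewrite [X in (X + _)%R]big_nat_cond [X in (X + _)%R]big1 ?add0r.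
      by apply: eq_big_nat => i /andP[-> _].
    by move=> i /andP[/andP[_ +] _]; rewrite ltnNge => /negbTE ->.
  (* The tolerance [t * e] compensates the later division by [t]. *)
  have /cvgrPdist_le /(_ (t * e)%R (mulr_gt0 t0 e0)) := aA.
  apply: filterS => n /(le_trans (ler_norm _)) An.
  by rewrite -(ler_pM2l t0); exact: le_trans (LA n) An.
have tailN n u : L (tail n (- u)%R) = (- L (tail n u))%R.
  rewrite -mulN1r -LZ//; congr L; apply/funext => k.
  by rewrite fctE /tail; case: ifP => _; rewrite ?scaler0 ?scaleN1r.
(* [tail 0 u] is constant, so [L] is [p u] there; each further rank splits off one [single n u]. *)
have series_tail n u : series (fun k => l k u) n = (p u - L (tail n u))%R.
  rewrite /series/=; elim: n => [|n IHn].
    rewrite big_nil (_ : tail 0 u = fun=> u)// (L_diag _ (p u)) ?subrr//.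
      by exists 0%N, u.
    by exists u.
  rewrite big_nat_recr//= IHn (_ : tail n u = single n u + tail n.+1 u)%R.
    by rewrite LD//= /l; ring.
  apply/funext => k; rewrite fctE /tail /single.
  by case: ltngtP => // _; rewrite ?addr0 ?add0r.
exists (fun n => Dual (mem_set (conj (l_lin n) (l_cont n)))); split=> [n z|].
  rewrite /=.
  have := fnNy n z; case fnz : (f_ n z) => [r| |]// _; last first.
    by rewrite (fin_nth fx) leey.
  rewrite (fin_nth fx) -EFinB lee_fin; apply: l_le.
  by rewrite addrC subrK fnz (fin_nth fx) -EFinD lee_fin/=; lra.
apply/weak_star_sumP => u /=.
apply/cvgrPdist_le => e e0; near=> n.
(* The error is [L (tail n u)]. [L_tail] bounds it from above only; the lower bound comes from
   [- u]. *)
rewrite series_tail opprB addrC subrK ler_norml; apply/andP; split.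
  by rewrite lerNl -tailN; near: n; exact: L_tail.
by near: n; exact: L_tail.
Unshelve. all: by end_near. Qed.

End Decomposition.

(** * Assembly of the five assertions *)

Theorem proposition15 (R : realType) (E : tvsType R)
    (sepE : hausdorff_space E)
    (f : E -> \bar R) (f_ : nat -> E -> \bar R)
    (f_convex : proper_convex f)
    (fn_convex : forall n, proper_convex (f_ n))
    (f_sum : forall x, ereal_series_sum (fun n => f_ n x) (f x)) :
  (* (i) *)
  ((forall (xs' : nat -> dual E) (x' : dual E),
      (forall n, dom (conjugate (f_ n)) (xs' n)) ->
      weak_star_sum xs' x' ->
      exists l : \bar R,
        [/\ -oo < l,
            ereal_series_sum (fun n => conjugate (f_ n) (xs' n)) l &
            conjugate f x' <= l]) /\
   (forall x' : dual E,
      conjugate f x' <= ereal_inf (decomposition_values f_ x'))) /\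
  (* (ii) *)
  (forall x' : dual E,
     (exists xs' : nat -> dual E,
        [/\ forall n, dom (conjugate (f_ n)) (xs' n),
            weak_star_sum xs' x' &
            exists r : R,
              ereal_series_sum (fun n => conjugate (f_ n) (xs' n)) r%:E]) ->
     dom (conjugate f) x') /\
  (* (iii) *)
  (forall (x : E) (xs' : nat -> dual E) (x' : dual E),
     (forall n, dom (f_ n) x) ->
     (forall n, subdifferential (f_ n) x (xs' n)) ->
     weak_star_sum xs' x' ->
     [/\ dom f x,
         subdifferential f x x',
         ereal_series_sum (fun n => conjugate (f_ n) (xs' n))
           (conjugate f x') &
         is_attained_inf (decomposition_values f_ x') (conjugate f x')]) /\
  (* (iv) *)
  (forall (x : E) (xs' : nat -> dual E) (x' : dual E),
     dom f x ->
     subdifferential f x x' ->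
     (forall n, dom (conjugate (f_ n)) (xs' n)) ->
     weak_star_sum xs' x' ->
     (ereal_series_sum (fun n => conjugate (f_ n) (xs' n)) (conjugate f x') <->
      (forall n, subdifferential (f_ n) x (xs' n)))) /\
  (* (v) *)
  ({within (dom f)°, continuous f} ->
   (forall n, {within (dom f)°, continuous (f_ n)}) ->
   (forall x' : dual E,
      (\bigcup_(x in (dom f)°) subdifferential f x) x' ->
      is_attained_inf (decomposition_values f_ x') (conjugate f x')) /\
   (forall (x : E) (x' : dual E),
      (dom f)° x ->
      subdifferential f x x' ->
      exists xs' : nat -> dual E,
        [/\ forall n, subdifferential (f_ n) x (xs' n),
            weak_star_sum xs' x' &
            ereal_series_sum (fun n => conjugate (f_ n) (xs' n))
              (conjugate f x')])).
Proof.
have [fNy f0 _] := f_convex.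
have fnNy n x : -oo < f_ n x by have [+ _ _] := fn_convex n; exact.
have fn_econvex n : econvex (f_ n) by have [] := fn_convex n.
have sub_sum := subdifferential_sum fNy fnNy f0 f_sum.
split; [split|split; [|split; [|split]]].
- by move=> xs' x'; exact: conjugate_sum_le.
- exact: conjugate_le_inf.
- move=> x' [xs' [dxs' xs'x' [r xs'r]]].
  have [l [_ xs'l]] := conjugate_sum_le fNy fnNy f0 f_sum dxs' xs'x'.
  rewrite -(cvg_unique (@ereal_hausdorff R) xs'r xs'l) => /le_lt_trans; apply.
  exact: ltry.
- by move=> x xs' x'; exact: sub_sum.
- by move=> x xs' x'; exact: conjugate_sum_eqP.
move=> _ fn_cont.
have decomp (x : E) (x' : dual E) : (dom f)° x -> subdifferential f x x' ->
    exists xs' : nat -> dual E, (forall n, dom (f_ n) x) /\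
      (forall n, subdifferential (f_ n) x (xs' n)) /\ weak_star_sum xs' x'.
  move=> xint fxx'.
  have [|xs' xs'P] := subdifferential_decomposition fNy fnNy fn_econvex f_sum
    xint fxx'.
    (* On an open set, continuity within the set amounts to continuity at each of its points. *)
    move=> n; have := fn_cont n.
    rewrite continuous_open_subspace; last exact: open_interior.
    by apply; rewrite inE.
  exists xs'; split=> // n.
  have := dom_fin_num_nth fnNy f_sum (interior_subset xint) n.
  by rewrite fin_numElt => /andP[].
split=> [x' [x xint fxx']|x x' xint fxx'].
  have [xs' [fnx [dxs' xs'x']]] := decomp x x' xint fxx'.
  by have [] := sub_sum x xs' x' fnx dxs' xs'x'.
have [xs' [fnx [dxs' xs'x']]] := decomp x x' xint fxx'.
by exists xs'; have [] := sub_sum x xs' x' fnx dxs' xs'x'.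
Qed.
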